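(* Let $\mathcal{C}$ be a $d$-uniform clutter with a perfect matching such that $\mathcal{C}$ has the packing property and $\alpha_0(\mathcal{C})=2$. Let $A$ be the incidence matrix of $\mathcal{C}$, and let $r$ be the rank of $A$. Then $$\Delta_r\begin{pmatrix}A\\ \mathbf{1}\end{pmatrix}=1,$$ where $\begin{pmatrix}A\\ \mathbf{1}\end{pmatrix}$ is the matrix obtained from $A$ by appending the row $\mathbf{1}=(1,\ldots,1)$.
   Context: A clutter $\mathcal{C}$ with finite vertex set $X=\{x_1,\ldots,x_n\}$ is a family of subsets of $X$ (called edges), none of which is included in another. Standing assumption: $\mathcal{C}$ has no isolated vertices, i.e., each vertex lies in at least one edge. $\mathcal{C}$ is $d$-uniform if every edge has exactly $d$ vertices. If $f_1,\ldots,f_q$ are the edges, the incidence matrix $A$ is the $n\times q$ matrix whose columns are $v_k=\sum_{x_i\in f_k}e_i\in\{0,1\}^n$. A minimal vertex cover is a subset of $X$ meeting every edge and minimal under inclusion with this property; $\alpha_0(\mathcal{C})$ is the smallest cardinality of a minimal vertex cover, and $\beta_1(\mathcal{C})$ is the maximum number of pairwise disjoint edges. A perfect matching is a set of pairwise disjoint edges whose union is $X$. The edge ideal of $\mathcal{C}$ is $I=I(\mathcal{C})=(x^{v_1},\ldots,x^{v_q})\subset R=K[x_1,\ldots,x_n]$, $K$ a field; this gives a one-to-one correspondence between clutters and square-free monomial ideals (the edges are the supports of the minimal monomial generators). A minor of $I$ is a proper ideal $I'$ of $R$ obtained from $I$ by setting some (possibly empty) set of variables equal to $0$ and some disjoint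 (possibly empty) set of variables equal to $1$ in the generators; a minor of $\mathcal{C}$ is a clutter corresponding to a minor of $I$. $\mathcal{C}$ satisfies the K\''onig property if $\alpha_0(\mathcal{C})=\beta_1(\mathcal{C})$, and satisfies the packing property if all its minors (including $\mathcal{C}$ itself) satisfy the K\''onig property. For an integral matrix $B$, $\Delta_r(B)$ denotes the greatest common divisor of all the nonzero $r\times r$ sub-determinants of $B$. *)

(* Defs.v *)
From mathcomp Require Import all_boot all_order all_algebra.
From mathcomp Require Import mpoly.

Set Implicit Arguments.
Unset Strict Implicit.
Unset Printing Implicit Defensive.

Import Order.TTheory GRing.Theory Num.Theory.
Local Open Scope ring_scope.

(** A family of edges on the vertex set {x_1, ..., x_n} is [E : {set {set 'I_n}}]. *)

Definition is_clutter n (E : {set {set 'I_n}}) : Prop :=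
  {in E &, forall e f : {set 'I_n}, e \subset f -> e = f}.

Definition no_isolated_vertex n (E : {set {set 'I_n}}) : Prop :=
  forall i : 'I_n, exists2 e, e \in E & i \in e.

Definition uniform n (d : nat) (E : {set {set 'I_n}}) : Prop :=
  {in E, forall e : {set 'I_n}, #|e| = d}.

Definition vertex_cover n (E : {set {set 'I_n}}) (S : {set 'I_n}) : bool :=
  [forall e in E, S :&: e != set0].

(** If no edge is empty then minimal vertex covers exist, and the default
    value [n] of the fold does not affect the minimum.  If the empty set is an
    edge there is no vertex cover and the value is the junk value [n]. *)
Definition alpha0 n (E : {set {set 'I_n}}) : nat :=
  \big[minn/n]_(S : {set 'I_n} | minset (vertex_cover E) S) #|S|.

Definition beta1 n (E : {set {set 'I_n}}) : nat :=
  \max_(M : {set {set 'I_n}} | (M \subset E) && trivIset M) #|M|.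

Definition has_perfect_matching n (E : {set {set 'I_n}}) : Prop :=
  exists M : {set {set 'I_n}},
    [/\ M \subset E, trivIset M & cover M = [set: 'I_n]].

Definition konig n (E : {set {set 'I_n}}) : Prop := alpha0 E = beta1 E.

Definition ideal_gen (R : comNzRingType) (gs : seq R) (p : R) : Prop :=
  exists c : 'I_(size gs) -> R, p = \sum_(k < size gs) c k * gs`_k.

Definition edge_monomials (K : fieldType) n (E : {set {set 'I_n}}) :
    seq {mpoly K[n]} :=
  [seq \prod_(i in e) 'X_i | e : {set 'I_n} <- enum E].

Definition edge_ideal (K : fieldType) n (E : {set {set 'I_n}}) :
    {mpoly K[n]} -> Prop :=
  ideal_gen (edge_monomials K E).

(** The substitution x_i := 0 for i in Z and x_i := 1 for i in U. *)
Definition set01 (K : fieldType) n (Z U : {set 'I_n}) (p : {mpoly K[n]}) :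
    {mpoly K[n]} :=
  p \mPo [tuple (if i \in Z then 0 else if i \in U then 1 else 'X_i) | i < n].

Definition minor_ideal (K : fieldType) n (E : {set {set 'I_n}})
    (Z U : {set 'I_n}) : {mpoly K[n]} -> Prop :=
  ideal_gen [seq set01 Z U g | g <- edge_monomials K E].

(** Minors are ideals of the same ring K[x_1, ..., x_n], so their clutters are
    kept on the vertex set ['I_n] and may have isolated vertices; these belong
    to no edge and to no minimal vertex cover.  The zero ideal is allowed. *)
Definition is_minor (K : fieldType) n (E E' : {set {set 'I_n}}) : Prop :=
  is_clutter E' /\
  exists Z U : {set 'I_n},
    [/\ [disjoint Z & U],
        ~ minor_ideal E Z U (1 : {mpoly K[n]})
      & forall p : {mpoly K[n]}, edge_ideal E' p <-> minor_ideal E Z U p].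

Definition packing (K : fieldType) n (E : {set {set 'I_n}}) : Prop :=
  forall E' : {set {set 'I_n}}, is_minor K E E' -> konig E'.

Definition incidence n (E : {set {set 'I_n}}) : 'M[int]_(n, #|E|) :=
  \matrix_(i < n, k < #|E|) (i \in enum_val k)%:R.

Definition int_rank m q (B : 'M[int]_(m, q)) : nat :=
  \rank (map_mx intr B : 'M[rat]_(m, q)).

Definition increasing r m (f : {ffun 'I_r -> 'I_m}) : bool :=
  [forall i : 'I_r, forall j : 'I_r, (i < j)%N ==> (f i < f j)%N].

(** The r x r submatrices of B are indexed by the increasing choices of r rows
    and r columns; 0 is neutral for [gcdn]. *)
Definition Delta m q (r : nat) (B : 'M[int]_(m, q)) : nat :=
  \big[gcdn/0%N]_(fg : {ffun 'I_r -> 'I_m} * {ffun 'I_r -> 'I_q} |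
      [&& increasing fg.1, increasing fg.2 & \det (mxsub fg.1 fg.2 B) != 0])
    `|\det (mxsub fg.1 fg.2 B)|%N.

(* Main.v *)
(* The clutter has two complementary edges [f] and [~: f].  Applying the packing
   property to minors that no single vertex covers (they have two disjoint edges)
   yields a Hall condition for the bipartite graph of two-element covers between
   [f] and [~: f], hence for every vertex [i] a vertex [y] such that each edge
   contains exactly one of [i] and [y].  So over any field the row space of
   (A; 1) is spanned by the all-ones row and the distinct rows of A indexed by
   [f].  These rows are indicator functions of sets of edges, and the packing
   property shows that they are linearly independent over every field.  The rank
   of (A; 1) modulo each prime is therefore at least the rational rank r of A, so
   no prime divides all the r x r minors. *)

Require Import Defs.
From mathcomp Require Import all_boot all_order all_algebra.
From mathcomp Require Import mpoly.

Set Implicit Arguments.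
Unset Strict Implicit.
Unset Printing Implicit Defensive.

Import GRing.Theory.

(** * Minors of an edge ideal as clutters *)

Section Minors.
Local Open Scope ring_scope.

Lemma ideal_gen_mem (R : comNzRingType) (gs : seq R) (g : R) :
  g \in gs -> ideal_gen gs g.
Proof.
move=> g_in; have lt_g : (index g gs < size gs)%N by rewrite index_mem.
exists (fun k => (k == Ordinal lt_g)%:R).
rewrite (bigD1 (Ordinal lt_g)) //= eqxx mul1r nth_index // big1 ?addr0 //.
by move=> k /negPf ->; rewrite mul0r.
Qed.

Lemma ideal_gen_mull (R : comNzRingType) (gs : seq R) (a p : R) :
  ideal_gen gs p -> ideal_gen gs (a * p).
Proof.
case=> c ->; exists (fun k => a * c k); rewrite mulr_sumr.
by apply: eq_bigr => k _; rewrite mulrA.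
Qed.

Lemma ideal_gen0 (R : comNzRingType) (gs : seq R) : ideal_gen gs 0.
Proof. by exists (fun=> 0); rewrite big1 // => k _; rewrite mul0r. Qed.

Lemma ideal_genD (R : comNzRingType) (gs : seq R) (p q : R) :
  ideal_gen gs p -> ideal_gen gs q -> ideal_gen gs (p + q).
Proof.
case=> c -> [c' ->]; exists (fun k => c k + c' k); rewrite -big_split /=.
by apply: eq_bigr => k _; rewrite mulrDl.
Qed.

Lemma ideal_gen_sub (R : comNzRingType) (gs hs : seq R) :
  (forall g, g \in gs -> ideal_gen hs g) ->
  forall p, ideal_gen gs p -> ideal_gen hs p.
Proof.
move=> sub_gs p [c ->]; elim/big_ind: _ => [|p1 p2|k _].
- exact: ideal_gen0.
- exact: ideal_genD.
- by apply/ideal_gen_mull/sub_gs/mem_nth.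
Qed.

Lemma set01_monomial (K : fieldType) n (Z U e : {set 'I_n}) :
  set01 Z U (\prod_(i in e) 'X_i : {mpoly K[n]}) =
  if [disjoint e & Z] then \prod_(i in e :\: U) 'X_i else 0.
Proof.
rewrite /set01 rmorph_prod /=.
under eq_bigr => i _ do rewrite comp_mpolyXU -tnth_nth tnth_mktuple.
case: ifPn => [dis_eZ|/pred0Pn[i /andP[/= ie iZ]]]; last first.
  by rewrite (bigD1 i) //= iZ mul0r.
rewrite [LHS](bigID (mem U)) /= big1 => [|i /andP[ie iU]]; last first.
  by rewrite (disjointFr dis_eZ ie) iU.
rewrite mul1r; apply: eq_big => [i|i /andP[ie iU]]; first by rewrite !inE andbC.
by rewrite (disjointFr dis_eZ ie) (negPf iU).
Qed.

(** Supports of the nonzero generators of the minor ideal; the inclusion-minimal ones generate the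
    same ideal. *)
Definition minor_family n (E : {set {set 'I_n}}) (Z U : {set 'I_n}) :
    pred {set 'I_n} :=
  fun h => [exists e in E, [disjoint e & Z] && (h == e :\: U)].

Definition minor_clutter n (E : {set {set 'I_n}}) (Z U : {set 'I_n}) :=
  [set h : {set 'I_n} | minset (minor_family E Z U) h].

Lemma minor_clutter_sub n (E : {set {set 'I_n}}) (Z U e : {set 'I_n}) :
  e \in E -> [disjoint e & Z] ->
  exists2 h, h \in minor_clutter E Z U & h \subset e :\: U.
Proof.
move=> eE eZ; have [|h min_h sub_h] := @minset_exists _ (minor_family E Z U) (e :\: U).
  by apply/existsP; exists e; rewrite eE eZ eqxx.
by exists h; rewrite ?inE.
Qed.

Lemma minor_clutter_lift n (E : {set {set 'I_n}}) (Z U h : {set 'I_n}) :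
  h \in minor_clutter E Z U ->
  exists e, [/\ e \in E, [disjoint e & Z] & h = e :\: U].
Proof.
rewrite inE => /minsetp/existsP[e /and3P[eE eZ /eqP h_e]].
by exists e.
Qed.

Lemma minor_clutterP (K : fieldType) n (E : {set {set 'I_n}}) (Z U : {set 'I_n}) :
  [disjoint Z & U] ->
  {in E, forall e : {set 'I_n}, [disjoint e & Z] -> ~~ (e \subset U)} ->
  is_minor K E (minor_clutter E Z U).
Proof.
move=> dis_ZU proper; split.
  move=> e f; rewrite !inE => min_e /minsetP[_ min_f] sub_ef.
  exact: min_f (minsetp min_e) sub_ef.
exists Z, U; split=> // [[c one_c]|p].
  have /negP[] : 1 != 0 :> K by exact: oner_neq0.
  (* Evaluation at the origin kills every generator, since by [proper] each nonzero one keeps a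
     variable. *)
  rewrite -[1](rmorph1 (meval (fun=> 0 : K) : {mpoly K[n]} -> K)) one_c.
  rewrite rmorph_sum big1 //= => k _; rewrite rmorphM /=.
  have /mapP[g /mapP[e]] := mem_nth 0 (ltn_ord k).
  rewrite mem_enum => eE -> ->; rewrite set01_monomial.
  case: ifP => eZ; last by rewrite rmorph0 mulr0.
  have /set0Pn[i ieU] : e :\: U != set0 by rewrite setD_eq0 proper.
  by rewrite rmorph_prod (bigD1 i) //= mevalXU mul0r mulr0.
split; apply: ideal_gen_sub => g.
  case/mapP=> h; rewrite mem_enum => /minor_clutter_lift[e [eE eZ ->]] ->.
  apply: ideal_gen_mem; apply/mapP; exists (\prod_(i in e) 'X_i).
    by apply/mapP; exists e; rewrite ?mem_enum.
  by rewrite set01_monomial eZ.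
case/mapP=> m /mapP[e]; rewrite mem_enum => eE -> ->; rewrite set01_monomial.
case: ifP => eZ; last exact: ideal_gen0.
have [h hE' sub_h] := minor_clutter_sub U eE eZ.
rewrite (big_setID h) /= (setIidPr sub_h) mulrC.
apply/ideal_gen_mull/ideal_gen_mem/mapP.
by exists h; rewrite ?mem_enum.
Qed.

End Minors.

(** * Covering numbers and the packing property *)

Lemma leq_alpha0 n (E : {set {set 'I_n}}) k :
  k <= n -> (forall S, vertex_cover E S -> k <= #|S|) -> k <= alpha0 E.
Proof.
(* The bound [k <= n] takes care of the default value [n] of the fold. *)
move=> le_kn cov; rewrite /alpha0; elim/big_ind: _ => // [x y|S /minsetp].
  by rewrite leq_min => -> ->.
exact: cov.
Qed.

Lemma alpha0_leq n (E : {set {set 'I_n}}) S :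
  vertex_cover E S -> alpha0 E <= #|S|.
Proof.
move=> /minset_exists[T min_T sub_T]; apply: leq_trans (subset_leq_card sub_T).
by rewrite /alpha0 -Order.NatOrder.minEnat -Order.NatOrder.leEnat; apply: Order.TotalTheory.bigmin_le_cond.
Qed.

Lemma alpha0_leq_size n (E : {set {set 'I_n}}) : alpha0 E <= n.
Proof.
rewrite /alpha0; elim/big_rec: _ => // S m _ le_mn.
exact: leq_trans (geq_minr _ _) le_mn.
Qed.

(** The form in which packing is applied: a minor that no single vertex covers has covering number
    at least 2, so by König it has two disjoint edges, whose lifts to [E] meet only in contracted
    vertices. *)
Lemma packing_two_edges (K : fieldType) n (E : {set {set 'I_n}})
    (Z U : {set 'I_n}) :
  packing K E -> 2 <= n -> [disjoint Z & U] ->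
  (forall v, exists2 h, h \in E & [disjoint h & Z] && (v \notin h :\: U)) ->
  exists e1 e2, [/\ e1 \in E, e2 \in E, [disjoint e1 & Z], [disjoint e2 & Z]
                  & e1 :&: e2 \subset U].
Proof.
move=> pack n_ge2 dis_ZU avoid.
(* If a surviving edge lies in [U], the ideal is not proper and packing says nothing; that edge
   taken twice works. *)
have [/exists_inP[e eE /andP[eZ eU]]|/exists_inPn proper] :=
  boolP [exists e in E, [disjoint e & Z] && (e \subset U)].
  by exists e, e; split=> //; rewrite setIid.
have konigE' : konig (minor_clutter E Z U).
  apply/pack/minor_clutterP=> // e eE eZ.
  by move: (proper e eE); rewrite eZ.
have : 2 <= beta1 (minor_clutter E Z U).
  rewrite -konigE'; apply: leq_alpha0 => // S covS; rewrite ltnNge.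
  apply/negP=> S_le1.
  have [v sub_Sv] : exists v, S \subset [set v].
    have [S0|[v vS]] := set_0Vmem S.
      by exists (Ordinal (ltnW n_ge2)); rewrite S0 sub0set.
    exists v; apply/subsetP=> w wS; rewrite inE.
    by move/card_le1P: S_le1 => /(_ v vS w); rewrite wS !inE => /esym.
  have [h hE /andP[hZ vhU]] := avoid v.
  have [h' h'E' sub_h'] := minor_clutter_sub U hE hZ.
  have /set0Pn[w /setIP[wS wh']] := forall_inP covS h' h'E'.
  have := subsetP sub_Sv w wS; rewrite inE => /eqP w_v.
  by move: vhU; rewrite -w_v (subsetP sub_h').
have [M /andP[sub_M triv_M] ->] : {M : {set {set 'I_n}} |
    (M \subset minor_clutter E Z U) && trivIset M
    & beta1 (minor_clutter E Z U) = #|M|}.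
  apply: eq_bigmax_cond; apply/card_gt0P; exists set0.
  by rewrite unfold_in sub0set; apply/trivIsetP=> A B; rewrite inE.
case/card_gt1P=> h1 [h2 [h1M h2M neq_h]].
have [e1 [e1E e1Z h1e]] := minor_clutter_lift (subsetP sub_M _ h1M).
have [e2 [e2E e2Z h2e]] := minor_clutter_lift (subsetP sub_M _ h2M).
exists e1, e2; split=> //; apply/subsetP=> w /setIP[we1 we2].
have /pred0P/(_ w) := trivIsetP triv_M _ _ h1M h2M neq_h.
by rewrite /= h1e h2e !inE we1 we2 !andbT andbb => /negbFE.
Qed.

(** * Two-element covers and their bipartite graph *)

Lemma not_cover2P n (E : {set {set 'I_n}}) (x y : 'I_n) :
  ~~ vertex_cover E [set x; y] ->
  exists h, [/\ h \in E, x \notin h & y \notin h].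
Proof.
move=> /forall_inPn[h hE]; rewrite negbK => /eqP/setP hxy.
exists h; split=> //; apply/negP=> w_h.
  by move: (hxy x); rewrite !inE eqxx w_h.
by move: (hxy y); rewrite !inE eqxx orbT w_h.
Qed.

Lemma cover2_mem n (E : {set {set 'I_n}}) (x y : 'I_n) (h : {set 'I_n}) :
  vertex_cover E [set x; y] -> h \in E -> x \notin h -> y \in h.
Proof.
move=> /forall_inP cov /cov/set0Pn[w /setIP[]].
by rewrite !inE => /orP[] /eqP -> // ->.
Qed.

(** For [Z] inside [f], this is the neighbourhood of [Z] in the bipartite graph of two-element
    covers between [f] and [~: f]. *)
Definition partners n (E : {set {set 'I_n}}) (f Z : {set 'I_n}) : {set 'I_n} :=
  [set y in ~: f | [exists z in Z, vertex_cover E [set z; y]]].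

Lemma partnersP n (E : {set {set 'I_n}}) (f Z : {set 'I_n}) (y : 'I_n) :
  reflect (y \notin f /\ exists2 z, z \in Z & vertex_cover E [set z; y])
          (y \in partners E f Z).
Proof.
rewrite !inE; apply: (iffP andP) => [[yf /exists_inP]|[yf]] //.
by move=> z_y; split=> //; apply/exists_inP.
Qed.

Lemma partnersS n (E : {set {set 'I_n}}) (f Z W : {set 'I_n}) :
  Z \subset W -> partners E f Z \subset partners E f W.
Proof.
move=> sZW; apply/subsetP=> y /partnersP[yf [z zZ cov]].
by apply/partnersP; split=> //; exists z; rewrite // (subsetP sZW).
Qed.

Lemma partnersU n (E : {set {set 'I_n}}) (f Z W : {set 'I_n}) :
  partners E f (Z :|: W) = partners E f Z :|: partners E f W.
Proof.
apply/eqP; rewrite eqEsubset subUset !partnersS ?subsetUl ?subsetUr // !andbT.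
apply/subsetP=> y /partnersP[yf [z /setUP[] zZ cov]]; apply/setUP.
  by left; apply/partnersP; split=> //; exists z.
by right; apply/partnersP; split=> //; exists z.
Qed.

Lemma partners_disjoint n (E : {set {set 'I_n}}) (f Z : {set 'I_n}) :
  [disjoint partners E f Z & f].
Proof.
rewrite disjoints_subset; apply/subsetP=> y /partnersP[yf _].
by rewrite inE.
Qed.

(** This is why deleting [Z] goes with contracting its partners: they are common to all surviving
    edges. *)
Lemma partners_sub_edge n (E : {set {set 'I_n}}) (f Z h : {set 'I_n}) :
  h \in E -> [disjoint h & Z] -> partners E f Z \subset h.
Proof.
move=> hE hZ; apply/subsetP=> y /partnersP[_ [z zZ cov]].
by apply: cover2_mem cov hE _; rewrite (disjointFl hZ zZ).
Qed.

(** * Hall's condition and complementary vertices *)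

Section Cuboid.

Variables (K : fieldType) (n d : nat) (E : {set {set 'I_n}}).
Hypotheses (unifE : uniform d E) (packE : packing K E).
Hypotheses (n_ge2 : 2 <= n) (n_eq : n = d.*2).
Variable f : {set 'I_n}.
Hypotheses (fE : f \in E) (fcE : ~: f \in E).

(* If [Z] violates the bound, deleting [Z] and contracting its partners gives a
   minor covered by one vertex [v]; deleting [v] and contracting [f :\: Z] then
   gives disjoint edges [h1], [h2] splitting [Z] into two sets [Z :\: hi] whose
   partners are disjoint, so one of them is a smaller violation. *)
Lemma hall (Z : {set 'I_n}) : Z \subset f -> #|Z| <= #|partners E f Z|.
Proof.
have [m] := ubnP #|Z|; elim: m => // m IHm in Z * => lt_Zm sZf.
rewrite leqNgt; apply/negP=> lt_NZ.
have dis_ZN : [disjoint Z & partners E f Z].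
  by rewrite disjoint_sym (disjointWr sZf) ?partners_disjoint.
have [v vcov] : exists v, forall h, h \in E -> [disjoint h & Z] ->
    v \in h :\: partners E f Z.
  have [/existsP[v /forall_inP vP]|/existsPn avoid] := boolP [exists v,
      forall (h | (h \in E) && [disjoint h & Z]), v \in h :\: partners E f Z].
    by exists v => h hE hZ; apply: vP; rewrite hE.
  have [|e1 [e2 [e1E e2E e1Z e2Z e12]]] := packing_two_edges packE n_ge2 dis_ZN.
    move=> v; have /forall_inPn[h /andP[hE hZ] vh] := avoid v.
    by exists h; rewrite ?hZ.
  (* Both edges avoid [Z] and have [d] of the [2d] vertices, so they share at least [#|Z|] vertices,
     too many to be all partners of [Z]. *)
  have : #|e1 :|: e2| + #|Z| <= d.*2.
    rewrite -n_eq; have := cardsC Z; rewrite card_ord => cZ; rewrite -[leqRHS]cZ addnC leq_add2l.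
    by rewrite subset_leq_card // subUset -!disjoints_subset e1Z.
  rewrite -(leq_add2r #|e1 :&: e2|) addnAC cardsUI (unifE e1E) (unifE e2E).
  rewrite addnn leq_add2l leqNgt => /negP[].
  exact: leq_ltn_trans (subset_leq_card e12) lt_NZ.
have /setDP[] : v \in ~: f :\: partners E f Z.
  by apply: vcov; rewrite // disjoint_sym disjoints_subset setCK.
rewrite inE => vf vN.
have dis_v : [disjoint [set v] & f :\: Z].
  by rewrite disjoints1 inE (negPf vf) andbF.
(* No [u] covers this minor: outside [Z] it misses [Z], the trace of [f]; in [Z], some edge misses
   both [u] and [v], as [v] is no partner of [Z]. *)
have [u|h1 [h2 [h1E h2E]]] := packing_two_edges packE n_ge2 dis_v.
  have [uZ|uZ] := boolP (u \in Z); last first.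
    exists f; rewrite // disjoint_sym disjoints1 vf !inE (negPf uZ) /=.
    by case: (u \in f).
  have /not_cover2P[h [hE uh vh]] : ~~ vertex_cover E [set u; v].
    by apply: contra vN => cov; apply/partnersP; split=> //; exists u.
  by exists h; rewrite // disjoint_sym disjoints1 vh inE (negPf uh) andbF.
rewrite ![[disjoint _ & [set v]]]disjoint_sym !disjoints1 => vh1 vh2 h12.
(* By the choice of [v], an edge missing [v] meets [Z], so induction applies. *)
have proper_part h : h \in E -> v \notin h -> #|Z :\: h| <= #|partners E f (Z :\: h)|.
  move=> hE vh; apply: IHm; last exact: subset_trans (subsetDl _ _) sZf.
  rewrite ltnS in lt_Zm; apply: leq_trans lt_Zm.
  apply: proper_card; rewrite properE subsetDl /=.
  apply: contra vh => /subsetP sZh.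
  have /setDP[] // : v \in h :\: partners E f Z.
  apply: vcov; rewrite // disjoint_sym; apply/pred0P=> z /=.
  by apply/andP=> [[/sZh/setDP[_ /negPf ->]]].
have sub_h h : h \in E -> partners E f (Z :\: h) \subset h.
  by move=> hE; apply: partners_sub_edge; rewrite // disjoint_sym disjoints_subset
    setDE subsetIr.
have ZU : (Z :\: h1) :|: (Z :\: h2) = Z.
  rewrite -setDIr; apply/setDidPl; rewrite disjoint_sym.
  by apply: disjointWl h12 _; rewrite disjoints_subset setDE subsetIr.
have disN : [disjoint partners E f (Z :\: h1) & partners E f (Z :\: h2)].
  apply/pred0P=> y /=; apply/andP=> [[y1 y2]].
  have /(subsetP h12)/setDP[yf _] : y \in h1 :&: h2.
    by rewrite inE (subsetP (sub_h h1 _)) // (subsetP (sub_h h2 _)).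
  by case/partnersP: y1; rewrite yf.
have /negP[] : ~~ (#|Z| <= #|partners E f Z|) by rewrite -ltnNge.
rewrite -{2}ZU partnersU cardsU (disjoint_setI0 disN) cards0 subn0.
apply: leq_trans (leq_add (proper_part h1 h1E vh1) (proper_part h2 h2E vh2)).
by rewrite -{1}ZU leq_card_setU.
Qed.

Definition tight (Z : {set 'I_n}) := (Z \subset f) && (#|partners E f Z| == #|Z|).

(** Submodularity of the neighbourhood size, with Hall's condition applied to both the union and the
    intersection. *)
Lemma tightU (Z W : {set 'I_n}) : tight Z -> tight W -> tight (Z :|: W).
Proof.
move=> /andP[sZ /eqP tZ] /andP[sW /eqP tW].
rewrite /tight subUset sZ sW /= eqn_leq hall ?subUset ?sZ // andbT partnersU.
rewrite -(leq_add2r #|partners E f Z :&: partners E f W|) cardsUI tZ tW.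
rewrite -cardsUI leq_add2l; apply: leq_trans (_ : _ <= #|partners E f (Z :&: W)|) _.
  by rewrite hall // subIset ?sZ.
by rewrite subset_leq_card // subsetI !partnersS ?subsetIl ?subsetIr.
Qed.

Lemma card_edgeC h : h \in E -> #|f :\: h| = #|h :\: f|.
Proof.
move=> hE; apply/eqP; rewrite -(eqn_add2l #|f :&: h|) cardsID setIC cardsID.
by rewrite (unifE fE) (unifE hE).
Qed.

(** One inclusion comes from the covers; Hall's condition and uniformity force equality of sizes. *)
Lemma partners_edge h : h \in E -> partners E f (f :\: h) = h :\: f.
Proof.
move=> hE; apply/eqP; rewrite eqEcard -card_edgeC // hall ?subsetDl // andbT.
rewrite subsetD partners_disjoint andbT partners_sub_edge //.
by rewrite disjoint_sym disjoints_subset setDE subsetIr.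
Qed.

Lemma tight_edge h : h \in E -> tight (f :\: h).
Proof. by move=> hE; rewrite /tight subsetDl partners_edge // card_edgeC //= eqxx. Qed.

(* The sets [f :\: h] with [h] an edge through [i] are tight for Hall's
   condition, hence so is their union [W]; as [i] is not in [W], Hall's
   condition for [i |: W] yields a partner of [i] that is no partner of [W]. *)
Lemma complementary_vertex i : i \in f ->
  exists2 y, y \notin f & {in E, forall h : {set 'I_n}, (y \in h) = (i \notin h)}.
Proof.
move=> i_f; pose W := \bigcup_(h in E | i \in h) (f :\: h).
have tW : tight W.
  rewrite /W; elim/big_ind: _ => [||h /andP[hE _]]; last exact: tight_edge.
  - rewrite /tight sub0set cards0 cards_eq0 -subset0; apply/subsetP=> y.
    by case/partnersP=> _ [z]; rewrite inE.
  - exact: tightU.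
have iW : i \notin W by apply/bigcupP=> [[h /andP[_ ih]]]; rewrite inE ih.
have [sWf /eqP cW] := andP tW.
have [y yi yW] : exists2 y, y \in partners E f [set i] & y \notin partners E f W.
  apply/subsetPn; apply: contraL (_ : #|i |: W| <= #|partners E f (i |: W)|).
    by rewrite partnersU => /setUidPr ->; rewrite cW cardsU1 iW -ltnNge.
  by apply: hall; rewrite subUset sub1set i_f.
have [yf [_ /set1P -> cov]] := partnersP _ _ _ _ yi.
exists y => // h hE; apply/idP/idP => [yh|ih]; last exact: cover2_mem cov hE ih.
apply: contra yW => ih; apply: (subsetP (partnersS _ _ (_ : f :\: h \subset W))).
  by apply: bigcup_sup; rewrite hE.
by rewrite partners_edge // inE yf.
Qed.

(** Encodes row [i] of the incidence matrix by its support. *)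
Definition star (i : 'I_n) : {set {set 'I_n}} := [set e in E | i \in e].

(* [e1] and [e2] are disjoint edges of the minor obtained by deleting [x] and
   contracting its partners; on [f] they miss exactly the vertices whose star is
   contained in that of [x]. *)
Lemma star_sub_pair x : x \in f ->
  exists e1 e2, [/\ e1 \in E, e2 \in E & {in f, forall i,
    (i \in e1) + (i \in e2) + (star i \subset star x) = 1}].
Proof.
move=> xf; have dis : [disjoint [set x] & partners E f [set x]].
  by rewrite disjoint_sym (disjointWr _ (partners_disjoint E f _)) ?sub1set.
have [v|e1 [e2 [e1E e2E]]] := packing_two_edges packE n_ge2 dis.
  have xfc : [disjoint ~: f & [set x]] by rewrite disjoint_sym disjoints1 inE xf.
  have [vN|vN] := boolP (v \in partners E f [set x]).
    by exists (~: f); rewrite // xfc inE vN.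
  have [vf|vf] := boolP (v \in f); first by exists (~: f); rewrite // xfc !inE vf andbF.
  have /not_cover2P[h [hE xh vh]] : ~~ vertex_cover E [set x; v].
    by apply: contra vN => cov; apply/partnersP; split=> //; exists x; rewrite ?inE.
  by exists h; rewrite // disjoint_sym disjoints1 xh inE (negPf vh) andbF.
rewrite ![[disjoint _ & [set x]]]disjoint_sym !disjoints1 => xe1 xe2 /subsetP e12.
exists e1, e2; split=> // i i_f.
have nN y : y \in f -> y \notin partners E f [set x].
  by move=> yf; rewrite (disjointFl (partners_disjoint _ _ _)).
have star_out e : e \in E -> x \notin e -> i \in e -> star i \subset star x = false.
  move=> eE xe ie; apply/negP=> /subsetP/(_ e).
  by rewrite !inE eE ie (negPf xe) => /(_ isT).
have [ie1|ie1] := boolP (i \in e1).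
  rewrite (star_out e1) // addn0; have [ie2|//] := boolP (i \in e2).
  by have := nN i i_f; rewrite e12 // inE ie1.
have [ie2|ie2] := boolP (i \in e2); first by rewrite (star_out e2).
(* With [i] in neither edge, its complement [y] is in both, hence a partner of [x]; an edge through
   [i] misses [y], so contains [x]. *)
have [y yf yP] := complementary_vertex i_f.
have /partnersP[_ [_ /set1P -> cov]] : y \in partners E f [set x].
  by apply: e12; rewrite inE !yP ?ie1.
rewrite (_ : _ \subset _) //; apply/subsetP=> h; rewrite !inE => /andP[hE ih].
rewrite hE; apply/negPn/negP=> xh.
by have := cover2_mem cov hE xh; rewrite yP ?ih.
Qed.

End Cuboid.

(** * Ranks modulo primes and determinantal divisors *)

Section Rank.
Local Open Scope ring_scope.

Lemma increasing_enum_val m r (A : {set 'I_m}) (cardA : #|A| = r) :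
  increasing [ffun i : 'I_r => enum_val (cast_ord (esym cardA) i)].
Proof.
have sorted_A : sorted ltn (map val (enum A)).
  apply: (subseq_sorted ltn_trans) (iota_ltn_sorted 0 m).
  by rewrite -val_enum_ord map_subseq // enumT filter_subseq.
apply/forallP=> i; apply/forallP=> j; apply/implyP=> lt_ij; rewrite !ffunE.
have lt_size k : (k < r)%N -> (k < size (enum A))%N by rewrite -cardE cardA.
have [x0 _] : exists x0 : 'I_m, true by exists (enum_val (cast_ord (esym cardA) i)).
rewrite !(enum_val_nth x0) /=.
rewrite -!(nth_map _ 0%N val) ?lt_size //.
by apply: (sorted_ltn_nth ltn_trans 0%N sorted_A); rewrite ?inE ?size_map ?lt_size.
Qed.

Lemma increasing_rowsub_free (F : fieldType) m q r (M : 'M[F]_(m, q)) :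
  (r <= \rank M)%N ->
  exists2 f : {ffun 'I_r -> 'I_m}, increasing f & row_free (rowsub f M).
Proof.
move=> le_r; pose h := maxrankfun M \o widen_ord le_r.
have h_inj : injective h.
  by move=> i j /maxrankfun_inj/(congr1 val)/= /val_inj.
have h_free : row_free (rowsub h M).
  have free1 : row_free (rowsub (widen_ord le_r) 1%:M : 'M[F]_(r, \rank M)).
    apply/row_freeP; exists (rowsub (widen_ord le_r) 1%:M)^T.
    apply/matrixP=> i j; rewrite !mxE (bigD1 (widen_ord le_r i)) //= !mxE eqxx mul1r.
    rewrite big1 ?addr0 => [|k /negPf neq_k].
      by rewrite eq_sym; congr (_%:R); rewrite -!val_eqE.
    by rewrite !mxE eq_sym neq_k mul0r.
  rewrite /row_free /h rowsub_comp -[X in rowsub _ X]mul1mx -mul_rowsub_mx.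
  by rewrite mxrankMfree // maxrowsub_free.
(* The choice [h] need not be monotone; listing its image in increasing order keeps the row
   space. *)
pose A := [set h i | i : 'I_r].
have cardA : #|A| = r by rewrite card_imset // card_ord.
exists [ffun i : 'I_r => enum_val (cast_ord (esym cardA) i)].
  exact: increasing_enum_val.
rewrite /row_free eqn_leq rank_leq_row -{1}(eqP h_free) mxrankS //.
apply/row_subP=> i; rewrite row_rowsub.
have hA : h i \in A by apply: imset_f.
rewrite -[h i](enum_rankK_in hA hA) -(cast_ordK cardA (enum_rank_in hA (h i))).
set k := cast_ord cardA _.
have -> : enum_val (cast_ord (esym cardA) k) =
    [ffun i : 'I_r => enum_val (cast_ord (esym cardA) i)] k by rewrite ffunE.
by rewrite -row_rowsub row_sub.
Qed.

Lemma increasing_minor_neq0 (F : fieldType) m q r (M : 'M[F]_(m, q)) :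
  (r <= \rank M)%N ->
  exists (f : {ffun 'I_r -> 'I_m}) (g : {ffun 'I_r -> 'I_q}),
    [/\ increasing f, increasing g & \det (mxsub f g M) != 0].
Proof.
case/increasing_rowsub_free=> f inc_f free_f.
have [g inc_g free_g] : exists2 g : {ffun 'I_r -> 'I_q},
    increasing g & row_free (rowsub g (rowsub f M)^T).
  by apply: increasing_rowsub_free; rewrite mxrank_tr (eqP free_f).
exists f, g; split=> //; rewrite -det_tr -unitfE -unitmxE -row_free_unit.
by congr (is_true (row_free _)): free_g; apply/matrixP=> i j; rewrite !mxE.
Qed.

(** A prime dividing the gcd (any prime, if the gcd is 0) would kill all these minors modulo [p],
    against the rank there. *)
Lemma Delta_eq1 m q r (B : 'M[int]_(m, q)) :
  (forall p, prime p -> r <= \rank (map_mx intr B : 'M['F_p]_(m, q)))%N ->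
  Delta r B = 1%N.
Proof.
move=> rankB; apply/eqP/negPn/negP=> Delta_neq1.
have [p p_pr p_dvd] : exists2 p, prime p & (p %| Delta r B)%N.
  have [->|Delta_gt0] := posnP (Delta r B); first by exists 2%N.
  exists (pdiv (Delta r B)); rewrite ?pdiv_dvd // pdiv_prime //.
  by rewrite ltn_neqAle eq_sym Delta_neq1.
have [f [g [inc_f inc_g]]] := increasing_minor_neq0 (rankB p p_pr).
rewrite -map_mxsub det_map_mx => det_neq0.
have det_neq0Z : \det (mxsub f g B) != 0.
  by apply: contraNneq det_neq0 => ->; rewrite rmorph0.
have : (Delta r B %| `|\det (mxsub f g B)|)%N.
  by apply: (biggcdn_inf (f, g)); rewrite /= ?inc_f ?inc_g.
move=> /(dvdn_trans p_dvd) p_dvd_det; case/negP: det_neq0.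
rewrite [\det _]intEsign rmorphM mulf_eq0 /= orbC.
by rewrite -pmulrn -(dvdn_pcharf (pchar_Fp p_pr)) p_dvd_det.
Qed.

End Rank.

(** * A basis of the row space, valid over every field *)

Section StarMatrix.
Local Open Scope ring_scope.

Variables (K : fieldType) (n d : nat) (E : {set {set 'I_n}}).
Hypotheses (unifE : uniform d E) (packE : packing K E).
Hypotheses (n_ge2 : (2 <= n)%N) (n_eq : n = d.*2).
Variable f : {set 'I_n}.
Hypotheses (fE : f \in E) (fcE : ~: f \in E).

(** Being a set, it counts equal rows once, as independence requires. *)
Definition stars : {set {set {set 'I_n}}} := [set star E i | i in f].

Definition star_mx (F : fieldType) : 'M[F]_(#|stars| + 1, #|E|) :=
  col_mx (\matrix_(k < #|stars|, e < #|E|) (enum_val e \in enum_val k)%:R) (const_mx 1).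

Lemma starsP (k : 'I_#|stars|) : exists2 i, i \in f & enum_val k = star E i.
Proof. by have /imsetP := enum_valP k. Qed.

(* Evaluating a relation between the rows at [~: f] kills the coefficient of the
   all-ones row; evaluating it at [f], [e1], [e2] of [star_sub_pair] shows that
   the coefficients of the stars contained in a given star sum to 0. *)
Lemma star_mx_free (F : fieldType) : row_free (star_mx F).
Proof.
apply: inj_row_free => v; rewrite -[v]hsubmxK /star_mx mul_row_col.
move: (lsubmx v) (rsubmx v) => c t /rowP vW0.
have cE e : e \in E -> \sum_k c 0 k * (e \in enum_val k)%:R = - t 0 0.
  move=> eE; apply/eqP; rewrite -addr_eq0; apply/eqP.
  have := vW0 (enum_rank_in eE e); rewrite [RHS]mxE; apply: etrans.
  rewrite !mxE big_ord1 !mxE mulr1; congr (_ + _).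
  by apply: eq_bigr => k _; rewrite !mxE enum_rankK_in.
have t0 : t 0 0 = 0.
  apply: oppr_inj; rewrite -(cE _ fcE) oppr0 big1 // => k _.
  by have [i i_f ->] := starsP k; rewrite !inE i_f andbF mulr0.
have sub0 (k : 'I_#|stars|) : \sum_j c 0 j * (enum_val j \subset enum_val k)%:R = 0.
  have [x xf ->] := starsP k.
  have [e1 [e2 [e1E e2E e12]]] := star_sub_pair unifE packE n_ge2 n_eq fE fcE xf.
  transitivity (\sum_j c 0 j * (f \in enum_val j)%:R
    - \sum_j c 0 j * (e1 \in enum_val j)%:R
    - \sum_j c 0 j * (e2 \in enum_val j)%:R); last first.
    by rewrite !cE // t0 !oppr0 !addr0.
  rewrite -!sumrB; apply: eq_bigr => j _; have [i i_f ->] := starsP j.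
  rewrite !inE fE e1E e2E i_f /=; move: (e12 i i_f).
  by case: (i \in e1) (i \in e2) (_ \subset _) => [] [] [] // _;
    rewrite !(mulr0, mulr1, subrr, subr0).
(* The relations [sub0] are triangular for inclusion: induction on the size of the star leaves only
   its own coefficient. *)
have c0 (k : 'I_#|stars|) : c 0 k = 0.
  have [m] := ubnP #|enum_val k|; elim: m => // m IHm in k * => le_km.
  rewrite -(sub0 k) (bigD1 k) //= subxx mulr1 big1 ?addr0 // => j neq_jk.
  have [sub_jk|] := boolP (_ \subset _); last by rewrite mulr0.
  rewrite IHm ?mul0r //; rewrite ltnS in le_km; apply: leq_trans le_km.
  apply: proper_card; rewrite properEneq sub_jk andbT.
  by apply: contraNneq neq_jk => /enum_val_inj ->.
apply/rowP=> k; rewrite mxE [RHS]mxE; case: splitP => j _; first exact: c0.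
by rewrite ord1.
Qed.

Lemma row_star_mx_star (F : fieldType) x (xf : x \in f) :
  row (lshift 1 (enum_rank_in (imset_f (star E) xf : star E x \in stars) (star E x)))
      (star_mx F)
    = row x (map_mx intr (incidence E)).
Proof.
apply/rowP=> e; rewrite mxE col_mxEu !mxE enum_rankK_in ?imset_f //.
by rewrite !inE enum_valP /= rmorph_nat.
Qed.

(** A row outside [f] is the all-ones row minus the row of a complementary vertex in [f], obtained
    by exchanging [f] and [~: f]. *)
Lemma rank_incidence_le : (int_rank (incidence E) <= #|stars| + 1)%N.
Proof.
apply: leq_trans (rank_leq_row (star_mx rat)); apply: mxrankS; apply/row_subP=> i.
have sub_f x : x \in f -> (row x (map_mx intr (incidence E)) <= star_mx rat)%MS.
  by move=> xf; rewrite -row_star_mx_star row_sub.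
have [|i_f] := boolP (i \in f); first exact: sub_f.
have [||y] := complementary_vertex unifE packE n_ge2 n_eq fcE _ (_ : i \in ~: f).
- by rewrite setCK.
- by rewrite inE.
rewrite inE negbK => yf yP.
have -> : row i (map_mx intr (incidence E)) =
    row (rshift _ ord0) (star_mx rat) - row y (map_mx intr (incidence E)).
  apply/rowP=> e; rewrite [RHS]mxE [X in _ = X + _]mxE col_mxEd !mxE yP ?enum_valP //.
  by case: (i \in _); rewrite ?subr0 ?subrr.
by rewrite addmx_sub ?row_sub // eqmx_opp sub_f.
Qed.

Lemma rank_col_mx_ge (F : fieldType) :
  (#|stars| + 1 <= \rank (map_mx intr (col_mx (incidence E) (const_mx (1%R : int) : 'rV_#|E|))
     : 'M[F]_(n + 1, #|E|)))%N.
Proof.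
have /eqP <- := star_mx_free F; apply: mxrankS; rewrite map_col_mx col_mx_sub.
apply/andP; split; last first.
  by rewrite -addsmxE map_const_mx /= rmorph1 addsmxSr.
apply/row_subP=> k; have [x xf k_x] := starsP k.
have -> : row k (\matrix_(k < #|stars|, e < #|E|) (enum_val e \in enum_val k)%:R) =
    row x (map_mx intr (incidence E)) :> 'rV[F]_#|E|.
  by apply/rowP=> e; rewrite !mxE k_x inE enum_valP rmorph_nat.
by rewrite -addsmxE (submx_trans (row_sub _ _)) ?addsmxSl.
Qed.

End StarMatrix.

(** * Existence of two complementary edges *)

(** By König the perfect matching has at most 2 edges, so [n <= 2d]; two disjoint edges then fill
    the vertex set. *)
Lemma edge_complement (K : fieldType) (n d : nat) (E : {set {set 'I_n}}) :
  is_clutter E -> no_isolated_vertex E -> uniform d E ->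
  has_perfect_matching E -> packing K E -> alpha0 E = 2 ->
  n = d.*2 /\ exists2 f, f \in E & ~: f \in E.
Proof.
move=> clutE isoE unifE [M [sub_M triv_M cov_M]] packE alphaE.
have n_ge2 : 2 <= n by rewrite -alphaE alpha0_leq_size.
have d_gt0 : 0 < d.
  have [e eE e0] := isoE (Ordinal (ltnW n_ge2)).
  by rewrite -(unifE e eE); apply/card_gt0P; exists (Ordinal (ltnW n_ge2)).
have konigE : konig E.
  (* Being an antichain, [E] is its own minor with nothing deleted or contracted. *)
  have <- : minor_clutter E set0 set0 = E.
    have famE h : minor_family E set0 set0 h = (h \in E).
      apply/exists_inP/idP=> [[e eE /andP[_ /eqP ->]]|hE]; first by rewrite setD0.
      by exists h; rewrite // disjoint_sym disjoints_subset sub0set setD0 eqxx.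
    apply/setP=> h; rewrite inE; apply/minsetP/idP=> [[]|hE]; rewrite famE //.
    by split=> // e; rewrite famE => eE; exact: clutE.
  apply/packE/minor_clutterP=> [|e eE _]; first by rewrite disjoints_subset sub0set.
  by rewrite subset0 -card_gt0 unifE.
have n_le : n <= d.*2.
  have -> : n = #|M| * d.
    rewrite -[LHS]card_ord -cardsT -cov_M -(eqP triv_M) -sum_nat_const.
    by apply: eq_bigr => e /(subsetP sub_M)/unifE.
  rewrite -mul2n leq_mul2r -alphaE konigE; apply/orP; right.
  by apply: leq_bigmax_cond; rewrite sub_M triv_M.
have dis0 : [disjoint set0 & set0 : {set 'I_n}] by rewrite disjoints_subset sub0set.
have [v|e1 [e2 [e1E e2E _ _]]] := packing_two_edges packE n_ge2 dis0.
  have /not_cover2P[h [hE vh _]] : ~~ vertex_cover E [set v; v].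
    by apply/negP=> /alpha0_leq; rewrite alphaE setUid cards1.
  by exists h; rewrite // disjoint_sym disjoints_subset sub0set inE (negPf vh) andbF.
rewrite subset0 => /eqP e12.
have card12 : #|e1 :|: e2| = d.*2.
  by rewrite cardsU e12 cards0 subn0 !unifE // addnn.
split.
  apply/eqP; rewrite eqn_leq n_le -card12 /=.
  by have := max_card (mem (e1 :|: e2)); rewrite card_ord.
exists e1 => //; suff -> : ~: e1 = e2 by [].
apply/esym/eqP; rewrite eqEcard -disjoints_subset disjoint_sym -setI_eq0 e12 eqxx.
by rewrite cardsCs setCK card_ord !unifE // leq_subLR addnn.
Qed.

Theorem theorem4p1 (K : fieldType) (n d : nat) (E : {set {set 'I_n}})
    (HE : is_clutter E) (Hiso : no_isolated_vertex E) (Hd : uniform d E)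
    (Hpm : has_perfect_matching E) (Hpack : packing K E)
    (Halpha : alpha0 E = 2) :
  Delta (int_rank (incidence E))
        (col_mx (incidence E) (const_mx (1%R : int) : 'rV[int]_#|E|)) = 1.
Proof.
have [n_eq [f fE fcE]] := edge_complement HE Hiso Hd Hpm Hpack Halpha.
have n_ge2 : 2 <= n by rewrite -Halpha alpha0_leq_size.
apply: Delta_eq1 => p _.
exact: leq_trans (rank_incidence_le Hd Hpack n_ge2 n_eq fE fcE)
  (rank_col_mx_ge Hd Hpack n_ge2 n_eq fE fcE _).
Qed.
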